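(* For any non-empty string $S$, $|\mathcal{PS}_S| \leq (3|S|-1)/2$. Moreover, this bound is tight: for every odd integer $n \geq 5$ there exists a string $T$ of length $n$ such that $|\mathcal{PS}_T| = (3n-1)/2$.
   Context: For a string $S$ of length $n$ (over some alphabet) and $1 \le i \le j \le n$, $S[i..j]$ is the substring from position $i$ to position $j$, and $\#\mathit{occ}_S(w)$ is the number of positions $i$ with $S[i..i+|w|-1]=w$. A non-empty substring $w$ is unique if $\#\mathit{occ}_S(w)=1$ and repeating if $\#\mathit{occ}_S(w)\ge 2$; an interval $[i,j]$ is called unique/repeating according to $S[i..j]$. For intervals, $[s,t]\subset[i,j]$ means $i\le s$ and $t\le j$. For an interval $[s,t]$ with $1\le s\le t\le n$, an interval $[i,j]$ is a shortest unique substring (SUS) for $[s,t]$ if (1) $S[i..j]$ is unique, (2) $[s,t]\subset[i,j]$, and (3) $S[i'..j']$ is repeating for every $[i',j']$ with $[s,t]\subset[i',j']$ and $j'-i'<j-i$. For a position $p$, $\mathsf{SUS}_S(p)$ denotes the set of SUSs for $[p,p]$ (point SUSs for $p$), and $\mathcal{PS}_S=\bigcup_{p=1}^{n}\mathsf{SUS}_S(p)$ is the set of all point SUSs of $S$ (a set of intervals). *)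

(* Defs.v *)
From mathcomp Require Import all_boot all_order all_algebra.

Set Implicit Arguments.
Unset Strict Implicit.
Unset Printing Implicit Defensive.

Section Strings.

Variable A : eqType.
Implicit Types (S w : seq A).

(* S[i..j], with 1-based positions, meaningful for 1 <= i <= j <= size S. *)
Definition substr S (i j : nat) : seq A := take (j.+1 - i) (drop i.-1 S).

Definition occ S w : nat :=
  count (fun i => (i + size w - 1 <= size S) &&
                  (substr S i (i + size w - 1) == w))
        (iota 1 (size S)).

Definition uniq_str S w : bool := (w != [::]) && (occ S w == 1).
Definition repeating_str S w : bool := (w != [::]) && (2 <= occ S w).

(* A pair (i, j) stands for the interval [i, j].  Positions are 1-based, so
   0 is an element of 'I_n.+1 but not a position: the intervals of a string of
   length n are exactly the pairs satisfying [is_interval]. *)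
Definition str_interval (n : nat) : finType := ('I_n.+1 * 'I_n.+1)%type.

Definition is_interval n (I : str_interval n) : bool := (1 <= I.1) && (I.1 <= I.2).

Definition subinterval n (I J : str_interval n) : bool :=
  (J.1 <= I.1) && (I.2 <= J.2).

Definition is_SUS S (I J : str_interval (size S)) : bool :=
  [&& is_interval J,
      uniq_str S (substr S J.1 J.2),
      subinterval I J &
      [forall K : str_interval (size S),
         [&& is_interval K, subinterval I K & K.2 - K.1 < J.2 - J.1]
         ==> repeating_str S (substr S K.1 K.2)]].

Definition point_SUS S (p : 'I_(size S).+1) : {set str_interval (size S)} :=
  [set J | is_SUS (p, p) J].

Definition PS S : {set str_interval (size S)} :=
  \bigcup_(p : 'I_(size S).+1 | 1 <= p) point_SUS p.

End Strings.

(* Main.v *)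
Require Import Defs.
From mathcomp Require Import all_boot all_order all_algebra.
From mathcomp Require Import zify lra.

Set Implicit Arguments.
Unset Strict Implicit.
Unset Printing Implicit Defensive.

Import GRing.Theory Num.Theory.

(* The unique intervals form an upward closed family.  A point SUS for p either
   is a minimal unique interval, or has p as its left end (a right extension
   from p) or p as its right end (a left extension from p).  Let m, r, l count
   the minimal intervals, the right and the left extensions.  Minimal intervals
   and right extensions have distinct left ends, so m + r <= n, and likewise
   m + l <= n.  Moreover r + l <= n - 1: call p double if it has both
   extensions; strictly between two consecutive double positions (also counting
   0 and n + 1 as double) the left end of a shortest unique interval has no
   extension at all.  Adding up, 2 (m + r + l) <= 3 n - 1.  Equality holds for
   a_1 x a_2 x ... x a_k with distinct letters and k >= 3. *)

(** * A counting lemma for sequences with values at most 2 *)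

(** If the value 2 occurs [t] times, these places cut the positions 1 to [n] into [t + 1] gaps, each
    with a zero in it. So zeros outnumber twos. *)
Lemma sum_lt_of_zero_between (w : nat -> nat) (n : nat) :
  w 0 = 0 -> (forall i, w i <= 2) ->
  (forall a b, a < b -> b <= n.+1 -> a = 0 \/ w a = 2 -> b = n.+1 \/ w b = 2 ->
     exists2 x, a < x < b & w x = 0) ->
  \sum_(i < n.+1) w i < n.
Proof.
move=> w0 w2 gap.
(* [a] is the last position up to [k] of value 2, or 0 if there is none. A zero after [a] brings the
   prefix sum below [k], which pays for the next 2. *)
have inv k : k <= n -> exists a, [/\ a <= k, a = 0 \/ w a = 2 &
    \sum_(i < k.+1) w i < k \/
    (\sum_(i < k.+1) w i <= k /\ forall x, a < x <= k -> w x <> 0)].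
  elim: k => [_|k IH lekn].
    by exists 0; split; [|left|right; rewrite big_ord1 w0; split=> // x; lia].
  have [a [leak bda IHs]] := IH (ltnW lekn).
  rewrite big_ord_recr /=; set s := \sum_(i < k.+1) w i in IHs *.
  have [wk2|wk2] := eqVneq (w k.+1) 2.
    exists k.+1; split; [by []|by right|right; split; last by move=> x; lia].
    case: IHs => [|[_ nz]]; first by lia.
    have [x lax wx] := gap a k.+1 leak (leqW lekn) bda (or_intror wk2).
    by case: (nz x); first lia.
  exists a; split; [by lia|by []|].
  have := w2 k.+1; case: IHs => [|[les nz]]; first by left; lia.
  have [wk0|wk0] := eqVneq (w k.+1) 0; first by left; lia.
  right; split; first by lia.
  move=> x; rewrite (leq_eqVlt x) => /andP[ltax /orP[/eqP->|ltxk]]; first lia.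
  by apply: nz; rewrite ltax.
have [a [lean bda [//|[_ nz]]]] := inv n (leqnn n).
have [x lax wx] := gap a n.+1 lean (leqnn _) bda (or_introl erefl).
by case: (nz x); first lia.
Qed.

(** * Families of intervals closed under enlargement *)

Section UpwardClosedIntervals.

Variables (n : nat) (U : nat -> nat -> bool).

Local Notation itv := (str_interval n).

Definition shortest (p : nat) (J : itv) : bool :=
  [&& U J.1 J.2, J.1 <= p <= J.2 &
      [forall K : itv, U K.1 K.2 && (K.1 <= p <= K.2) ==> (J.2 - J.1 <= K.2 - K.1)]].

(** By upward closure, minimality can be tested by dropping one end position at a time. For a
    singleton both tests concern empty intervals, which [U_bounds] excludes. *)
Definition minimals : {set itv} :=
  [set J : itv | [&& U J.1 J.2, ~~ U J.1.+1 J.2 & ~~ U J.1 J.2.-1]].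
Definition rexts : {set itv} :=
  [set J : itv | shortest J.1 J && U J.1.+1 J.2].
Definition lexts : {set itv} :=
  [set J : itv | shortest J.2 J && U J.1 J.2.-1].

Hypothesis U_bounds : forall i j, U i j -> [&& 1 <= i, i <= j & j <= n].
Hypothesis U_mono : forall i j i' j',
  U i j -> 1 <= i' <= i -> j <= j' <= n -> U i' j'.
Hypothesis U_full : U 1 n.

Lemma shortest_le p J a b :
  shortest p J -> U a b -> a <= p <= b -> J.2 - J.1 <= b - a.
Proof.
case/and3P=> _ _ /forallP minJ Uab; have := U_bounds Uab => ? apb.
have [lta ltb] : a < n.+1 /\ b < n.+1 by lia.
by have /implyP := minJ (Ordinal lta, Ordinal ltb); apply; rewrite Uab.
Qed.

Lemma shortest_U p J : shortest p J -> U J.1 J.2 /\ J.1 <= p <= J.2.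
Proof. by case/and3P. Qed.

Lemma shortest_trichotomy p J :
  shortest p J -> J \in minimals :|: rexts :|: lexts.
Proof.
move=> sJ; have [UJ /andP[J1p pJ2]] := shortest_U sJ.
rewrite !inE UJ /=.
have [Ur|_] := boolP (U J.1.+1 J.2).
  have /eqP eJ : J.1 == p :> nat.
    rewrite eqn_leq J1p leqNgt; apply/negP=> ltJp.
    have := shortest_le sJ Ur; have := U_bounds Ur; lia.
  by rewrite eJ sJ orbT.
have [Ul|_] := boolP (U J.1 J.2.-1); last by [].
have /eqP eJ : J.2 == p :> nat.
  rewrite eqn_leq pJ2 andbT leqNgt; apply/negP=> ltpJ.
  have := shortest_le sJ Ul; have := U_bounds Ul; lia.
by rewrite eJ sJ orbT.
Qed.

Lemma card_nonzero_ord (B : {set 'I_n.+1}) : ord0 \notin B -> #|B| <= n.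
Proof.
move=> nB; have cn : #|[set~ @ord0 n]| = n by rewrite cardsC1 card_ord.
rewrite -[X in _ <= X]cn; apply/subset_leq_card/subsetP=> x xB; rewrite !inE.
by apply: contraNneq nB => <-.
Qed.

(** Two members of [U] with a common left end are nested. The longer one is not minimal, by upward
    closure, and not shortest for that end, which the shorter one also contains. *)
Lemma left_end_inj : {in minimals :|: rexts &, injective (fun J : itv => J.1)}.
Proof.
have le J K : J \in minimals :|: rexts -> K \in minimals :|: rexts ->
    J.1 = K.1 -> K.2 <= J.2.
  move=> JX KX e1; rewrite leqNgt; apply/negP=> lt2.
  have UJ : U J.1 J.2.
    by move: JX; rewrite !inE => /orP[/and3P[]|/andP[/shortest_U[]]].
  have bJ := U_bounds UJ; have bK := ltn_ord K.2.
  move: KX; rewrite !inE => /orP[/and3P[_ _ /negP[]]|/andP[sK _]].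
    by rewrite -e1; apply: (U_mono UJ); lia.
  have := shortest_le sK UJ; rewrite e1; rewrite e1 in bJ; lia.
move=> J K JX KX e1; case: J K e1 JX KX => [a b] [c d] /= e1 JX KX.
congr (_, _) => //; apply/val_inj/eqP; rewrite eqn_leq.
by rewrite (le _ _ KX JX) ?(le _ _ JX KX).
Qed.

Lemma right_end_inj : {in minimals :|: lexts &, injective (fun J : itv => J.2)}.
Proof.
have le J K : J \in minimals :|: lexts -> K \in minimals :|: lexts ->
    J.2 = K.2 -> J.1 <= K.1.
  move=> JX KX e2; rewrite leqNgt; apply/negP=> lt1.
  have UJ : U J.1 J.2.
    by move: JX; rewrite !inE => /orP[/and3P[]|/andP[/shortest_U[]]].
  have bJ := U_bounds UJ.
  move: KX; rewrite !inE => /orP[/and3P[_ /negP nK _]|/andP[sK _]].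
    by apply: nK; rewrite -e2; apply: (U_mono UJ); lia.
  have := shortest_le sK UJ; rewrite e2; rewrite e2 in bJ; lia.
move=> J K JX KX e2; case: J K e2 JX KX => [a b] [c d] /= e2 JX KX.
congr (_, _) => //; apply/val_inj/eqP; rewrite eqn_leq.
by rewrite (le _ _ JX KX) ?(le _ _ KX JX).
Qed.

Lemma card_minimals_rexts : #|minimals| + #|rexts| <= n.
Proof.
have -> : #|minimals| + #|rexts| = #|minimals :|: rexts|.
  rewrite cardsU (_ : _ :&: _ = set0) ?cards0 ?subn0 //.
  apply/setP=> J; rewrite !inE; apply/negP.
  by move=> /andP[/and3P[_ /negbTE-> _] /andP[]].
rewrite -(card_in_imset left_end_inj); apply: card_nonzero_ord.
apply/imsetP=> -[J JX e0].
have : U J.1 J.2 by move: JX; rewrite !inE => /orP[/and3P[]|/andP[/shortest_U[]]].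
by move/U_bounds; rewrite -e0.
Qed.

Lemma card_minimals_lexts : #|minimals| + #|lexts| <= n.
Proof.
have -> : #|minimals| + #|lexts| = #|minimals :|: lexts|.
  rewrite cardsU (_ : _ :&: _ = set0) ?cards0 ?subn0 //.
  apply/setP=> J; rewrite !inE; apply/negP.
  by move=> /andP[/and3P[_ _ /negbTE->] /andP[]].
rewrite -(card_in_imset right_end_inj); apply: card_nonzero_ord.
apply/imsetP=> -[J JX e0].
have : U J.1 J.2 by move: JX; rewrite !inE => /orP[/and3P[]|/andP[/shortest_U[]]].
by move/U_bounds; rewrite -e0 /=; lia.
Qed.

(** The argument is a plain natural number, so that the predicate can act as a weight in the
    counting lemma and be evaluated at [n.+1]. *)
Definition has_rext (p : nat) : bool := [exists J in rexts, J.1 == p :> nat].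
Definition has_lext (p : nat) : bool := [exists J in lexts, J.2 == p :> nat].

Lemma has_rextP p : reflect
  (exists J : itv, [/\ shortest J.1 J, U J.1.+1 J.2 & J.1 = p :> nat]) (has_rext p).
Proof.
apply: (iffP exists_inP) => [[J]|[J [sJ UJ eJ]]].
  by rewrite inE => /andP[sJ UJ] /eqP eJ; exists J.
by exists J; [rewrite inE sJ | apply/eqP].
Qed.

Lemma has_lextP p : reflect
  (exists J : itv, [/\ shortest J.2 J, U J.1 J.2.-1 & J.2 = p :> nat]) (has_lext p).
Proof.
apply: (iffP exists_inP) => [[J]|[J [sJ UJ eJ]]].
  by rewrite inE => /andP[sJ UJ] /eqP eJ; exists J.
by exists J; [rewrite inE sJ | apply/eqP].
Qed.

Lemma card_rexts : #|rexts| = \sum_(i < n.+1) has_rext i.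
Proof.
have inj : {in rexts &, injective (fun J : itv => J.1)}.
  by apply: sub_in2 left_end_inj => J; rewrite in_setU orbC => ->.
rewrite -(card_in_imset inj) -sum1_card big_mkcond /=; apply: eq_bigr => i _.
suff -> : (i \in [set J.1 | J in rexts]) = has_rext i by case: has_rext.
apply/imsetP/exists_inP => -[J JR]; first by move->; exists J.
by move/eqP/val_inj=> <-; exists J.
Qed.

Lemma card_lexts : #|lexts| = \sum_(i < n.+1) has_lext i.
Proof.
have inj : {in lexts &, injective (fun J : itv => J.2)}.
  by apply: sub_in2 right_end_inj => J; rewrite in_setU orbC => ->.
rewrite -(card_in_imset inj) -sum1_card big_mkcond /=; apply: eq_bigr => i _.
suff -> : (i \in [set J.2 | J in lexts]) = has_lext i by case: has_lext.
apply/imsetP/exists_inP => -[J JR]; first by move->; exists J.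
by move/eqP/val_inj=> <-; exists J.
Qed.

(* Suppose K reaches q.  If p < J.1, then [p, q - 1] beats K; otherwise J without
   its right end contains p, so K is shorter than J although K contains q. *)
Lemma rext_lext_separated p q (K J : itv) : p < q ->
  shortest K.1 K -> U K.1.+1 K.2 -> K.1 = p :> nat ->
  shortest J.2 J -> U J.1 J.2.-1 -> J.2 = q :> nat ->
  K.2 < q.
Proof.
move=> ltpq sK UK eK sJ UJ eJ; rewrite ltnNge; apply/negP=> leqK.
have [/U_bounds bK _] := shortest_U sK; have [_ bJ] := shortest_U sJ.
have bUK := U_bounds UK; have bUJ := U_bounds UJ.
have [ltpJ|leJp] := ltnP p J.1.
  have UpJ : U p J.2.-1 by apply: (U_mono UJ); lia.
  have := shortest_le sK UpJ; lia.
have := shortest_le sK UJ; have := shortest_le sJ (shortest_U sK).1; lia.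
Qed.

(** Let [[x, y]] be a shortest member of [U] strictly inside the gap. An extension at [x] is no
    longer than [[x, y]]; dropping [x] from it gives a shorter member of [U] in the gap, unless a
    left extension reaches [a]. *)
Lemma exists_unextended_between a b : a < b -> b <= n.+1 ->
  a = 0 \/ has_rext a && has_lext a -> b = n.+1 \/ has_rext b && has_lext b ->
  exists2 x, a < x < b & ~~ has_rext x && ~~ has_lext x.
Proof.
move=> ltab lebn da db.
(* For a double [a], take its right extension without [a]: it is shorter than every member of [U]
   containing [a], and [rext_lext_separated] keeps it left of a double [b]. For [a = 0], take the
   left extension of [b] without [b], or all of [[1, n]]. *)
have [i0 [j0 [U0 lai ljb short]]] : exists i j, [/\ U i j, a < i, j < b &
    a = 0 \/ forall s t, s <= a <= t -> U s t -> j - i < t - s].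
  case: da => [-> | /andP[/has_rextP[K [sK UK eK]] _]].
    case: db => [-> | /andP[_ /has_lextP[J [sJ UJ eJ]]]].
      by exists 1, n; split=> //; left.
    by exists J.1, J.2.-1; have := U_bounds UJ; split=> //; try lia; left.
  exists K.1.+1, K.2; split=> //; first by lia.
    case: db => [-> //| /andP[_ /has_lextP[J [sJ UJ eJ]]]].
    exact: (rext_lext_separated ltab sK UK eK sJ UJ eJ).
  right=> s t lsat Ust; have := shortest_le sK Ust.
  by have := U_bounds UK; lia.
have b0 := U_bounds U0.
have [lti ltj] : i0 < n.+1 /\ j0 < n.+1 by lia.
pose P (K : itv) := [&& U K.1 K.2, a < K.1 & K.2 < b].
have P0 : P (Ordinal lti, Ordinal ltj) by rewrite /P U0 lai ljb.
case: (arg_minnP (fun K : itv => K.2 - K.1) P0) => [[x y] /and3P[/= Uxy lax lyb]] minP.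
have min s t : U s t -> a < s -> t < b -> y - x <= t - s.
  move=> Ust las ltb; have bst := U_bounds Ust.
  have [lts ltt] : s < n.+1 /\ t < n.+1 by lia.
  by apply: (minP (Ordinal lts, Ordinal ltt)); rewrite /P Ust las.
have bxy := U_bounds Uxy.
exists (x : nat); first by lia.
apply/andP; split.
  apply/has_rextP=> -[J [sJ UJ eJ]].
  have := shortest_le sJ Uxy; have := min _ _ UJ; have := U_bounds UJ; lia.
apply/has_lextP=> -[J [sJ UJ eJ]].
have leJ := shortest_le sJ Uxy; have bJ := U_bounds UJ.
have [laJ|leJa] := ltnP a J.1; first by have := min _ _ UJ; lia.
(* Here [J] contains [a], so it is longer than [[i0, j0]], hence than [[x, y]], against [leJ]. If
   [a = 0], this case contradicts [1 <= J.1]. *)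
have := min _ _ U0 lai ljb.
case: short => [|/(_ J.1 J.2 _ (shortest_U sJ).1)]; lia.
Qed.

Lemma card_rexts_lexts : #|rexts| + #|lexts| < n.
Proof.
rewrite card_rexts card_lexts -big_split /=.
apply: (@sum_lt_of_zero_between (fun i => has_rext i + has_lext i)).
- case: has_rextP => [[J [/shortest_U[/U_bounds]]]|_]; first lia.
  by case: has_lextP => [[J [/shortest_U[/U_bounds]]]|_]; first lia.
- by move=> i; case: has_rext; case: has_lext.
have eq2 (c d : bool) : c + d = 2 -> c && d by case: c; case: d.
move=> a b ltab leb da db.
have [||x lx /andP[/negbTE rx /negbTE lx']] := exists_unextended_between ltab leb.
- by case: da => [->|/eq2]; [left|right].
- by case: db => [->|/eq2]; [left|right].
by exists x; rewrite ?rx ?lx'.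
Qed.

Lemma card_point_shortest (X : {set itv}) :
  (forall J, J \in X -> exists p, shortest p J) -> 2 * #|X| < 3 * n.
Proof.
move=> sX.
have : #|X| <= #|minimals :|: rexts :|: lexts|.
  by apply/subset_leq_card/subsetP=> J /sX[p /shortest_trichotomy].
have [+ _] := leq_card_setU (minimals :|: rexts) lexts.
have [+ _] := leq_card_setU minimals rexts.
have := card_minimals_rexts; have := card_minimals_lexts.
have := card_rexts_lexts; lia.
Qed.

End UpwardClosedIntervals.

(** * Unique substrings as an upward closed family *)

Lemma count_uniq_eq1 (T : eqType) (P : pred T) (s : seq T) (x : T) :
  uniq s -> x \in s -> P x ->
  reflect {in s, forall y, P y -> y = x} (count P s == 1).
Proof.
move=> us xs Px; apply: (iffP eqP) => [c1 y ys Py|eqx].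
  move: c1; rewrite -size_filter.
  have : y \in filter P s by rewrite mem_filter Py.
  have : x \in filter P s by rewrite mem_filter Px.
  by case: (filter P s) => [|z []] //; rewrite !inE => /eqP-> /eqP->.
have -> : count P s = count_mem x s.
  apply: eq_in_count => y ys /=; apply/idP/eqP => [/(eqx y ys) //|->//].
by rewrite count_uniq_mem ?xs.
Qed.

Section UniqueSubstrings.

Variables (A : eqType) (x0 : A) (S : seq A).

Lemma size_substr i j : 1 <= i <= j -> j <= size S ->
  size (substr S i j) = (j - i).+1.
Proof. by move=> lij ljn; rewrite size_takel ?size_drop; lia. Qed.

Lemma nth_substr i j d : 1 <= i -> d <= j - i -> i <= j ->
  nth x0 (substr S i j) d = nth x0 S (i + d).-1.
Proof. by move=> *; rewrite nth_take ?nth_drop; [congr nth; lia|lia]. Qed.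

Lemma substr_eqP k i j : 1 <= k -> k + (j - i) <= size S -> 1 <= i <= j ->
  j <= size S ->
  reflect (forall d, d <= j - i -> nth x0 S (k + d).-1 = nth x0 S (i + d).-1)
          (substr S k (k + (j - i)) == substr S i j).
Proof.
move=> k1 kn lij ljn; apply: (iffP eqP) => [e d ld|e].
  by rewrite -[RHS](@nth_substr i j) -?e ?nth_substr //; lia.
apply: (@eq_from_nth _ x0) => [|d]; rewrite !size_substr //; try lia.
by move=> ld; rewrite !nth_substr ?e //; lia.
Qed.

Lemma occ_pred_self i j : 1 <= i <= j -> j <= size S ->
  (i + size (substr S i j) - 1 <= size S) &&
  (substr S i (i + size (substr S i j) - 1) == substr S i j).
Proof.
move=> lij ljn; rewrite size_substr //.
by have -> : i + (j - i).+1 - 1 = j; [lia | rewrite ljn eqxx].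
Qed.

Lemma substr_neq0 i j : 1 <= i <= j -> j <= size S -> substr S i j != [::].
Proof. by move=> lij ljn; rewrite -size_eq0 size_substr. Qed.

(** Trades counting occurrences for comparing letters. The predecessors turn 1-based positions into
    0-based indices of [nth]. *)
Lemma uniq_substrP i j : 1 <= i <= j -> j <= size S ->
  reflect (forall k, 1 <= k -> k + (j - i) <= size S ->
             (forall d, d <= j - i -> nth x0 S (k + d).-1 = nth x0 S (i + d).-1) ->
             k = i)
          (uniq_str S (substr S i j)).
Proof.
move=> lij ljn; rewrite /uniq_str substr_neq0 //= /occ.
have si : i \in iota 1 (size S) by rewrite mem_iota; lia.
apply: (iffP (count_uniq_eq1 (iota_uniq _ _) si (occ_pred_self lij ljn))).
  move=> H k k1 kn e; apply: H; first by rewrite mem_iota; lia.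
  rewrite size_substr //; have -> : k + (j - i).+1 - 1 = k + (j - i) by lia.
  by rewrite kn; apply/substr_eqP.
move=> H k; rewrite mem_iota size_substr // => /andP[k1 _].
have -> : k + (j - i).+1 - 1 = k + (j - i) by lia.
by move=> /andP[kn /substr_eqP e]; apply: H => //; apply: e.
Qed.

Lemma not_uniq_repeating i j : 1 <= i <= j -> j <= size S ->
  ~~ uniq_str S (substr S i j) -> repeating_str S (substr S i j).
Proof.
move=> lij ljn; rewrite /uniq_str /repeating_str substr_neq0 //=.
suff : 0 < occ S (substr S i j) by lia.
rewrite -has_count; apply/hasP; exists i; last exact: occ_pred_self.
by rewrite mem_iota; lia.
Qed.

(** The bounds are built in because [substr] is meaningful only inside the string, while the
    interval argument needs [U_bounds]. *)
Definition uniq_itv (i j : nat) : bool :=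
  [&& 1 <= i, i <= j & j <= size S] && uniq_str S (substr S i j).

(** An occurrence of the longer substring at [k] contains one of the shorter at [k + (i - i')],
    which uniqueness places at [i]; so [k = i']. *)
Lemma uniq_itv_mono i j i' j' :
  uniq_itv i j -> 1 <= i' <= i -> j <= j' <= size S -> uniq_itv i' j'.
Proof.
move=> /andP[lij uij] li lj; apply/andP; split; first by lia.
apply/uniq_substrP; [lia|lia|move=> k k1 kn e].
move/uniq_substrP: uij => uij.
suff : k + (i - i') = i by lia.
apply: uij; [lia|lia|lia|lia|move=> d ld].
have -> : k + (i - i') + d = k + (i - i' + d) by lia.
by rewrite e; [congr nth; lia|lia].
Qed.

Lemma uniq_itv_full : S <> [::] -> uniq_itv 1 (size S).
Proof.
move/eqP; rewrite -size_eq0 -lt0n => n0; apply/andP; split; first by lia.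
by apply/uniq_substrP; [lia|lia|move=> k k1 kn _; lia].
Qed.

Lemma is_SUS_shortest (p : 'I_(size S).+1) (J : str_interval (size S)) :
  is_SUS (p, p) J -> shortest uniq_itv p J.
Proof.
case/and4P=> iJ uJ /= pJ /forallP minJ.
have bJ := ltn_ord J.2; have/andP[iJ1 iJ2] := iJ.
apply/and3P; split=> //; first by rewrite /uniq_itv uJ; lia.
apply/forallP=> K; apply/implyP=> /andP[/andP[bK uK] pK].
rewrite leqNgt; apply/negP=> ltKJ.
have /implyP/(_ _)/andP[|_] := minJ K.
  by case/and3P: bK => K1 K12 _; apply/and3P; split=> //; apply/andP.
by case/andP: uK => _ /eqP->.
Qed.

Lemma card_PS : S <> [::] -> 2 * #|PS S| < 3 * size S.
Proof.
move=> S0; apply: (card_point_shortest _ uniq_itv_mono (uniq_itv_full S0)).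
  by move=> i j /andP[].
by move=> J /bigcupP[p _]; rewrite inE => /is_SUS_shortest; exists p.
Qed.

End UniqueSubstrings.

(** * Strings attaining the bound *)

Section AlternatingStrings.

Variables (A : eqType) (x0 : A) (S : seq A).
Local Notation n := (size S).
Hypothesis odd_n : odd n.
Hypothesis uniq_odd : forall p, odd p -> p <= n -> uniq_itv S p p.
Hypothesis repeating_even : forall p, 1 <= p <= n -> ~~ odd p -> ~~ uniq_itv S p p.

Lemma mem_PS_odd_point (J : str_interval n) : odd J.1 -> J.1 = J.2 -> J \in PS S.
Proof.
move=> oJ eJ; have lJ : J.1 <= n by rewrite -ltnS.
have /andP[/and3P[bJ _ _] uJ] := uniq_odd oJ lJ.
apply/bigcupP; exists J.1 => //.
rewrite inE /is_SUS /is_interval /subinterval -eJ uJ leqnn bJ /=.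
by apply/forallP=> K; rewrite subnn ltn0 !andbF.
Qed.

(** The odd position of the pair makes it unique. The letter at the even one, [p], repeats, so
    nothing shorter around [p] is unique. *)
Lemma mem_PS_pair (J : str_interval n) : 1 <= J.1 -> J.2 = J.1.+1 :> nat -> J \in PS S.
Proof.
move=> J1 eJ; have bJ := ltn_ord J.2.
have [p [ep op pJ]] : exists p : 'I_n.+1, [/\ 1 <= p, ~~ odd p & J.1 <= p <= J.2].
  have [o1|e1] := boolP (odd J.1); last by exists J.1; split=> //; lia.
  by exists J.2; split; lia.
have uJ : uniq_itv S J.1 J.2.
  have [o1|e1] := boolP (odd J.1).
    by apply: (uniq_itv_mono x0 (uniq_odd o1 _)); lia.
  have o2 : odd J.2 by rewrite eJ.
  by apply: (uniq_itv_mono x0 (uniq_odd o2 _)); lia.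
apply/bigcupP; exists p => //; rewrite inE.
case/andP: (uJ) => _ uJ'; apply/and4P; split=> //.
  by rewrite /is_interval; lia.
apply/forallP=> K; apply/implyP=> /and3P[_ /andP[K1p pK2] lK].
have {}K1p : K.1 <= p := K1p; have {}pK2 : p <= K.2 := pK2.
have [-> ->] : K.1 = p :> nat /\ K.2 = p :> nat by lia.
have bp := ltn_ord p.
have nu : ~~ uniq_itv S p p by apply: repeating_even => //; lia.
apply: not_uniq_repeating; [lia|lia|].
by apply: contra nu; rewrite /uniq_itv => ->; lia.
Qed.

(** The [n - 1] pairs of adjacent positions and the [(n + 1) / 2] odd points are distinct point
    SUSs, [(3n - 1) / 2] in total. *)
Lemma card_PS_alternating : 3 * n <= (2 * #|PS S|).+1.
Proof.
pose f (i : 'I_n.-1) : str_interval n := (inord i.+1, inord i.+2).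
pose g (i : 'I_n.+1./2) : str_interval n := (inord i.*2.+1, inord i.*2.+1).
have f1 i : (f i).1 = i.+1 :> nat by rewrite inordK //; have := ltn_ord i; lia.
have f2 i : (f i).2 = i.+2 :> nat by rewrite inordK //; have := ltn_ord i; lia.
have g1 i : (g i).1 = i.*2.+1 :> nat by rewrite inordK //; have := ltn_ord i; lia.
have injf : injective f.
  by move=> i j e; apply: val_inj; have := f1 j; rewrite -e f1; case.
have injg : injective g.
  by move=> i j e; apply: val_inj; have := g1 j; rewrite -e g1 /=; lia.
have sub : (f @: setT) :|: (g @: setT) \subset PS S.
  apply/subsetP=> J /setUP[] /imsetP[i _ ->].
    by apply: mem_PS_pair; rewrite f1 ?f2.
  by apply: mem_PS_odd_point; rewrite // g1 /= odd_double.
have dis : [disjoint f @: setT & g @: setT].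
  apply/pred0P=> J /=; apply/negP=> /andP[/imsetP[i _ ->] /imsetP[j _ e]].
  have := f1 i; have := f2 i; rewrite e g1 /= => e2; have := g1 j => /=; lia.
have := subset_leq_card sub; rewrite cardsU (eqP _ : #|_ :&: _| = 0).
  rewrite !card_imset // !cardsT !card_ord; lia.
by rewrite cards_eq0 setI_eq0.
Qed.

End AlternatingStrings.

(** Letter 0 is the repeated [x], and each odd position carries its own number. Parity looks
    reversed because [mkseq] indexes from 0. *)
Definition alternating (n : nat) : seq 'I_n.+1 :=
  mkseq (fun i => inord (if odd i then 0 else i.+1)) n.

Lemma nth_alternating n p : 1 <= p <= n ->
  nth ord0 (alternating n) p.-1 = (if odd p then p else 0) :> nat.
Proof.
case: p => [//|p] /= lp; rewrite nth_mkseq // inordK; first by case: odd.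
by case: odd; lia.
Qed.

Lemma card_PS_alternating_ge n : odd n -> 5 <= n ->
  3 * n <= (2 * #|PS (alternating n)|).+1.
Proof.
move=> on n5; have sz : size (alternating n) = n by exact: size_mkseq.
rewrite -{1}sz; apply: (card_PS_alternating ord0); rewrite sz //.
- move=> p op lp; apply/andP; rewrite sz; split; first by lia.
  apply/(uniq_substrP ord0); rewrite ?sz; [lia|lia|].
  move=> k k1; rewrite subnn addn0 => kn /(_ 0 (leqnn _)).
  rewrite !addn0 => /(congr1 val) /=.
  by rewrite !nth_alternating ?op; [case: odd; lia|lia|lia].
move=> p lp ep; apply/negP=> /andP[_ /(uniq_substrP ord0)]; rewrite sz => H.
have {}H k : 1 <= k <= n -> ~~ odd k -> k = p.
  move=> /andP[k1 kn] ok; apply: H; rewrite ?subnn ?addn0 //; try lia.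
  move=> d; rewrite leqn0 => /eqP->; rewrite !addn0; apply: val_inj => /=.
  by rewrite !nth_alternating ?(negbTE ok) ?(negbTE ep) ?k1.
(* As [5 <= n], both 2 and 4 are positions of the letter 0, and [p] cannot equal both. *)
have := H 2; have := H 4; lia.
Qed.

Theorem theorem3 :
  (forall (A : eqType) (S : seq A), S <> [::] ->
     (#|PS S|%:R <= (3 * (size S)%:R - 1) / 2 :> rat)%R)
  /\
  (forall n : nat, odd n -> 5 <= n ->
     exists (A : finType) (T : seq A),
       size T = n /\
       (#|PS T|%:R = (3 * n%:R - 1) / 2 :> rat)%R).
Proof.
split=> [A S S0|n on n5].
  (* The default letter for [nth] comes from the non-empty string. *)
  have x0 : A by case: S S0.
  have := card_PS x0 S0; rewrite -(ler_nat rat) -natr1 !natrM; lra.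
have sz : size (alternating n) = n by exact: size_mkseq.
exists 'I_n.+1, (alternating n); split=> //.
have S0 : alternating n <> [::] by move=> e; rewrite e /= in sz; lia.
(* The general upper bound, applied to this very string, supplies the other inequality. *)
have e : (2 * #|PS (alternating n)|).+1 = 3 * n.
  apply/eqP; rewrite eqn_leq card_PS_alternating_ge // andbT.
  by rewrite -[X in _ <= 3 * X]sz; apply: (card_PS ord0).
by move/(congr1 (fun k => k%:R : rat)%R): e; rewrite -natr1 !natrM; lra.
Qed.
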